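(* The space $\overline{T(\mathbf I)}$ has the strongly discrete approximation property (SDAP). Hence $T(\mathbf I)$, $T^{PL}(\mathbf I)$ and $T^{PM}(\mathbf I)$ have SDAP.
   Context: $\mathbf I=[0,1]$; $C(\mathbf I)$ is the space of continuous self-maps of $\mathbf I$ with the supremum metric $d$; $T(\mathbf I)$ is the set of transitive maps ($f$ is transitive if for all non-empty open $U,V\subset\mathbf I$ there is $n\ge1$ with $U\cap f^{-n}(V)\ne\emptyset$), $\overline{T(\mathbf I)}$ its closure, and $T^{PL}(\mathbf I)$, $T^{PM}(\mathbf I)$ the sets of piecewise linear, respectively piecewise monotone, transitive maps. A metric space $(X,d)$ has SDAP if for every continuous $\varepsilon:X\to(0,1)$, every compact metric space $K$ and every continuous $f:K\times\mathbb N\to X$ ($\mathbb N$ discrete), there exists a continuous $g:K\times\mathbb N\to X$ such that the family $\{g(K\times\{n\}):n\in\mathbb N\}$ is discrete in $X$ and $d(f(k,n),g(k,n))<\varepsilon(f(k,n))$ for all $(k,n)\in K\times\mathbb N$. *)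

(* Defs.v *)
From Stdlib Require Import Reals List.
From Coquelicot Require Import Coquelicot.
Open Scope R_scope.

Definition J : Type := { x : R | 0 <= x <= 1 }.
Definition jval (x : J) : R := proj1_sig x.

Definition cont_map (f : J -> J) : Prop :=
  forall x : J, forall e, 0 < e -> exists delta, 0 < delta /\
    forall y : J, Rabs (jval y - jval x) < delta -> Rabs (jval (f y) - jval (f x)) < e.

Definition CI (f : J -> J) : Prop := cont_map f.

(* Supremum metric d(f,g) = sup_{x in I} |f x - g x| (finite: values lie in [0,1]). *)
Definition dsup (f g : J -> J) : R :=
  real (Lub_Rbar (fun r => exists x : J, r = Rabs (jval (f x) - jval (g x)))).

Definition openI (U : J -> Prop) : Prop :=
  forall x : J, U x -> exists r, 0 < r /\ forall y : J, Rabs (jval y - jval x) < r -> U y.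

Definition transitive (f : J -> J) : Prop :=
  forall U V : J -> Prop, openI U -> openI V -> (exists x, U x) -> (exists y, V y) ->
    exists n : nat, (1 <= n)%nat /\ exists x : J, U x /\ V (Nat.iter n f x).

Definition TI (f : J -> J) : Prop := CI f /\ transitive f.

Definition TI_closure (f : J -> J) : Prop :=
  CI f /\ forall e, 0 < e -> exists g, TI g /\ dsup f g < e.

Definition partitionI (m : nat) (a : nat -> R) : Prop :=
  a 0%nat = 0 /\ a m = 1 /\ forall i, (i < m)%nat -> a i < a (S i).

Definition piecewise_linear (f : J -> J) : Prop :=
  exists (m : nat) (a : nat -> R), partitionI m a /\
    forall i, (i < m)%nat -> exists s c : R, forall x : J,
      a i <= jval x <= a (S i) -> jval (f x) = s * jval x + c.

Definition piecewise_monotone (f : J -> J) : Prop :=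
  exists (m : nat) (a : nat -> R), partitionI m a /\
    forall i, (i < m)%nat ->
      (forall x y : J, a i <= jval x -> jval x <= jval y -> jval y <= a (S i) ->
         jval (f x) <= jval (f y)) \/
      (forall x y : J, a i <= jval x -> jval x <= jval y -> jval y <= a (S i) ->
         jval (f y) <= jval (f x)).

Definition TPL (f : J -> J) : Prop := TI f /\ piecewise_linear f.
Definition TPM (f : J -> J) : Prop := TI f /\ piecewise_monotone f.

Definition is_metric {K : Type} (dK : K -> K -> R) : Prop :=
  (forall x y, 0 <= dK x y) /\ (forall x y, dK x y = 0 <-> x = y) /\
  (forall x y, dK x y = dK y x) /\ (forall x y z, dK x z <= dK x y + dK y z).

Definition openK {K : Type} (dK : K -> K -> R) (U : K -> Prop) : Prop :=
  forall x, U x -> exists r, 0 < r /\ forall y, dK x y < r -> U y.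

Definition compact_metric {K : Type} (dK : K -> K -> R) : Prop :=
  forall C : (K -> Prop) -> Prop,
    (forall U, C U -> openK dK U) -> (forall x, exists U, C U /\ U x) ->
    exists l : list (K -> Prop), (forall U, In U l -> C U) /\
      forall x, exists U, In U l /\ U x.

Definition cont_into {K : Type} (dK : K -> K -> R) (h : K -> (J -> J)) : Prop :=
  forall k e, 0 < e -> exists delta, 0 < delta /\
    forall k', dK k k' < delta -> dsup (h k) (h k') < e.

Definition cont_on (X : (J -> J) -> Prop) (eps : (J -> J) -> R) : Prop :=
  forall f, X f -> forall e, 0 < e -> exists delta, 0 < delta /\
    forall h, X h -> dsup f h < delta -> Rabs (eps h - eps f) < e.

Definition discrete_family (X : (J -> J) -> Prop) {K : Type}
    (g : K -> nat -> (J -> J)) : Prop :=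
  forall p, X p -> exists r, 0 < r /\
    forall n m, (exists k, dsup p (g k n) < r) -> (exists k, dsup p (g k m) < r) -> n = m.

(* Strongly discrete approximation property of the subspace X of (C(I), d).
   A continuous map K x N -> X (N discrete) is given in curried form: a family of
   continuous maps K -> X indexed by n. *)
Definition SDAP (X : (J -> J) -> Prop) : Prop :=
  forall eps : (J -> J) -> R,
    (forall f, X f -> 0 < eps f < 1) -> cont_on X eps ->
  forall (K : Type) (dK : K -> K -> R), is_metric dK -> compact_metric dK ->
  forall f : K -> nat -> (J -> J),
    (forall k n, X (f k n)) -> (forall n, cont_into dK (fun k => f k n)) ->
  exists g : K -> nat -> (J -> J),
    (forall k n, X (g k n)) /\ (forall n, cont_into dK (fun k => g k n)) /\
    discrete_family X g /\
    (forall k n, dsup (f k n) (g k n) < eps (f k n)).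

(* Main.v *)
Require Import Defs.
From Stdlib Require Import Reals List.
From Coquelicot Require Import Coquelicot.
From Stdlib Require Import Lra Lia ZArith ProofIrrelevance IndefiniteDescription.

(** Given [f] in the closure of the transitive maps, an amplitude [a] and a fine mesh [1/M], let [g]
    be the piecewise linear map whose value at [j/M] is [f(j/M) + a] for [j] even and [f(j/M) - a]
    for [j] odd, truncated to [[0,1]]. It depends continuously on [f] and [a]. Its slopes are at
    least [4] in absolute value, so iterates of any open set swallow a whole lap; a lap is mapped
    over the [a/2]-neighbourhood of its image under [f], and [f] is chain transitive, so the
    iterates of a lap fill the interval. Hence [g] is transitive and piecewise linear, and one
    construction serves all four spaces.

    Take [a = eps f / 4] and meshes that at least halve from [n] to [n+1]. Zigzags of different
    meshes stay apart, and a sequence of them with [n] unbounded cannot converge to some [p]: the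
    amplitudes stay away from [0] (otherwise the maps [f] converge to [p] too, where [eps] is
    positive) while the laps shrink, against the continuity of [p]. *)

(** * Points of the unit interval, the supremum metric and compactness *)

Lemma jval_bounds (x : J) : 0 <= jval x <= 1.
Proof. exact (proj2_sig x). Qed.

Lemma jval_inj (x y : J) : jval x = jval y -> x = y.
Proof.
  destruct x as [x hx], y as [y hy]; simpl; intros ->.
  f_equal; apply proof_irrelevance.
Qed.

Lemma clamp_bounds (x : R) : 0 <= Rmax 0 (Rmin 1 x) <= 1.
Proof.
  split; [apply Rmax_l|].
  apply Rmax_lub; [lra | apply Rmin_l].
Qed.

Definition clampJ (x : R) : J := exist _ (Rmax 0 (Rmin 1 x)) (clamp_bounds x).

Lemma clampJ_val (x : R) : 0 <= x <= 1 -> jval (clampJ x) = x.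
Proof.
  intros hx; simpl.
  rewrite (Rmin_right 1 x), Rmax_right; lra.
Qed.

Lemma jval_clampJ_dist (x y : R) :
  Rabs (jval (clampJ x) - jval (clampJ y)) <= Rabs (x - y).
Proof.
  simpl; unfold Rmax, Rmin.
  repeat destruct Rle_dec; unfold Rabs; repeat destruct Rcase_abs; lra.
Qed.

Lemma dist_le_1 (x y : J) : Rabs (jval x - jval y) <= 1.
Proof.
  generalize (jval_bounds x) (jval_bounds y); intros; apply Rabs_le; lra.
Qed.

(** [real] sends infinite values to [0], so finiteness has to be shown: the differences are at most
    [1], and the one at the point [0] shows that the set is inhabited. *)
Lemma dsup_lub (f g : J -> J) :
  is_lub_Rbar (fun r => exists x : J, r = Rabs (jval (f x) - jval (g x)))
    (Finite (dsup f g)).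
Proof.
  unfold dsup.
  set (E := fun r => exists x : J, r = Rabs (jval (f x) - jval (g x))).
  destruct (Lub_Rbar_correct E) as [hub hlub].
  assert (h1 : Rbar_le (Lub_Rbar E) 1).
  { apply hlub; intros r [x ->]; apply dist_le_1. }
  assert (h0 : Rbar_le (Rabs (jval (f (clampJ 0)) - jval (g (clampJ 0)))) (Lub_Rbar E)).
  { apply hub; now exists (clampJ 0). }
  destruct (Lub_Rbar E) as [l | | ] eqn:hl; simpl in *; try easy.
Qed.

Lemma dsup_ge (f g : J -> J) (x : J) : Rabs (jval (f x) - jval (g x)) <= dsup f g.
Proof. apply (proj1 (dsup_lub f g)); now exists x. Qed.

Lemma dsup_le (f g : J -> J) (b : R) :
  (forall x, Rabs (jval (f x) - jval (g x)) <= b) -> dsup f g <= b.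
Proof.
  intros h; apply (proj2 (dsup_lub f g) (Finite b)).
  intros r [x ->]; apply h.
Qed.

Lemma dsup_triangle (f g h : J -> J) : dsup f h <= dsup f g + dsup g h.
Proof.
  apply dsup_le; intros x.
  generalize (dsup_ge f g x) (dsup_ge g h x)
    (Rabs_triang (jval (f x) - jval (g x)) (jval (g x) - jval (h x))).
  replace (jval (f x) - jval (g x) + (jval (g x) - jval (h x)))
    with (jval (f x) - jval (h x)) by ring.
  lra.
Qed.

Lemma dsup_refl (f : J -> J) : dsup f f <= 0.
Proof. apply dsup_le; intros x; rewrite Rminus_diag, Rabs_R0; lra. Qed.

Lemma dsup_sym (f g : J -> J) : dsup f g <= dsup g f.
Proof. apply dsup_le; intros x; rewrite Rabs_minus_sym; apply dsup_ge. Qed.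

Lemma cont_map_unif (f : J -> J) : cont_map f -> forall e, 0 < e ->
  exists delta, 0 < delta /\ forall x y : J,
    Rabs (jval x - jval y) < delta -> Rabs (jval (f x) - jval (f y)) < e.
Proof.
  intros hf e he.
  (* Heine's theorem concerns functions on the line; precomposition with the 1-Lipschitz [clampJ]
     extends [f] to it. *)
  destruct (@Heine_cor2 (fun x => jval (f (clampJ x))) 0 1) with (eps := mkposreal e he)
    as [[d hd] hh].
  { intros x hx e' he'.
    destruct (hf (clampJ x) e' he') as [d [hd hh]].
    exists d; split; [exact hd|]; intros y [_ hy]; apply hh.
    apply Rle_lt_trans with (2 := hy), jval_clampJ_dist. }
  exists d; split; [exact hd|]; intros x y hxy.
  specialize (hh (jval x) (jval y) (jval_bounds x) (jval_bounds y) hxy).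
  simpl in hh.
  assert (hc : forall z : J, clampJ (jval z) = z).
  { intros z; apply jval_inj, clampJ_val, jval_bounds. }
  now rewrite !hc in hh.
Qed.

(** Open sets carrying one threshold each cover [K]; the least threshold of a finite subcover works
    everywhere, since [P] passes to smaller positive thresholds. *)
Lemma compact_uniform {K : Type} (dK : K -> K -> R) (P : R -> K -> Prop) :
  is_metric dK -> compact_metric dK ->
  (forall s t k, 0 < s -> s <= t -> P t k -> P s k) ->
  (forall k0, exists r t, 0 < r /\ 0 < t /\ forall k, dK k0 k < r -> P t k) ->
  exists t, 0 < t /\ forall k, P t k.
Proof.
  intros [_ [hd0 [hds hdt]]] hc hP hloc.
  destruct (hc (fun U => openK dK U /\ exists t, 0 < t /\ forall k, U k -> P t k))
    as [l [hl hcov]].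
  - now intros U [].
  - intros k0; destruct (hloc k0) as [r [t [hr [ht h]]]].
    exists (fun k => dK k0 k < r); split; [split|].
    + intros x hx; exists (r - dK k0 x); split; [lra|].
      intros y hy; generalize (hdt k0 x y); lra.
    + now exists t.
    + now rewrite (proj2 (hd0 k0 k0) eq_refl).
  - assert (hmin : exists t, 0 < t /\ forall U, In U l -> forall k, U k -> P t k).
    { clear hcov; induction l as [|U l IH].
      - exists 1; split; [lra | intros U []].
      - destruct IH as [t [ht h]]; [intros V hV; apply hl; now right|].
        destruct (hl U (or_introl eq_refl)) as [_ [s [hs h']]].
        exists (Rmin s t).
        assert (hst : 0 < Rmin s t) by now apply Rmin_glb_lt.
        split; [exact hst|].
        intros V [<- | hV] k hk.
        + apply (hP _ s); auto using Rmin_l.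
        + apply (hP _ t); eauto using Rmin_r. }
    destruct hmin as [t [ht h]]; exists t; split; [exact ht|].
    intros k; destruct (hcov k) as [U [hU hk]]; eauto.
Qed.

(** * Piecewise linear interpolation at equidistant nodes *)

(** At [x = 1] the index is [M], and [y (S M)] enters with factor [0]. *)
Definition interp (y : nat -> R) (M : nat) (x : R) : R :=
  let j := Z.to_nat (Int_part (INR M * x)) in
  y j + (y (S j) - y j) * (INR M * x - INR j).

Lemma floor_nat (x : R) : 0 <= x ->
  INR (Z.to_nat (Int_part x)) <= x < INR (Z.to_nat (Int_part x)) + 1.
Proof.
  intros hx; destruct (base_Int_part x) as [h1 h2].
  assert (hz : (0 <= Int_part x)%Z).
  { assert (-1 < Int_part x)%Z; [apply lt_IZR; lra | lia]. }
  rewrite INR_IZR_INZ, Z2Nat.id by exact hz; lra.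
Qed.

Lemma interp_lap (y : nat -> R) (M j : nat) (x : R) :
  INR j <= INR M * x <= INR j + 1 ->
  interp y M x = y j + (y (S j) - y j) * (INR M * x - INR j).
Proof.
  intros hx; unfold interp.
  generalize (pos_INR j); intros hj.
  destruct (floor_nat (INR M * x)) as [h1 h2]; [lra|].
  set (i := Z.to_nat _) in *.
  (* At the right end of the lap the floor is already [S j]; the two affine pieces agree there. *)
  assert (hi : i = j \/ i = S j).
  { assert (i < S (S j))%nat by (apply INR_lt; rewrite !S_INR; lra).
    assert (j < S i)%nat by (apply INR_lt; rewrite S_INR; lra).
    lia. }
  destruct hi as [-> | ->]; [reflexivity|].
  rewrite S_INR in *.
  replace (INR M * x) with (INR j + 1) by lra; ring.
Qed.

Lemma lap_exists (M : nat) (x : R) : (0 < M)%nat -> 0 <= x <= 1 ->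
  exists j, (j < M)%nat /\ INR j <= INR M * x <= INR j + 1.
Proof.
  intros hM hx; assert (hM' := lt_INR _ _ hM); simpl in hM'.
  destruct (Rle_lt_dec 1 x) as [h | h].
  (* At [x = 1] the floor would give [M], which is not a lap; the point is the right end of the last
     one. *)
  - exists (M - 1)%nat; split; [lia|].
    rewrite minus_INR by lia; simpl; replace x with 1 by lra; lra.
  - destruct (floor_nat (INR M * x)) as [h1 h2]; [nra|].
    exists (Z.to_nat (Int_part (INR M * x))); split; [|lra].
    apply INR_lt; nra.
Qed.

Lemma interp_close (y : nat -> R) (M : nat) (x v e : R) : (0 < M)%nat -> 0 <= x <= 1 ->
  (forall j, INR j <= INR M * x <= INR j + 1 ->
    Rabs (y j - v) <= e /\ Rabs (y (S j) - v) <= e) ->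
  Rabs (interp y M x - v) <= e.
Proof.
  intros hM hx h.
  destruct (lap_exists M x hM hx) as [j [_ hj]].
  rewrite (interp_lap y M j x hj).
  destruct (h j hj) as [h0 h1]; apply Rabs_le_between in h0, h1.
  apply Rabs_le; set (t := INR M * x - INR j).
  assert (0 <= t <= 1) by (unfold t; lra); nra.
Qed.

Lemma interp_bounds (y : nat -> R) (M : nat) (x : R) : (0 < M)%nat -> 0 <= x <= 1 ->
  (forall j, 0 <= y j <= 1) -> 0 <= interp y M x <= 1.
Proof.
  intros hM hx hy.
  (* The interval is the closed ball of radius [1/2] about [1/2], so the convexity of [interp_close]
     applies. *)
  assert (h : Rabs (interp y M x - 1/2) <= 1/2).
  { apply interp_close; auto; intros j _.
    generalize (hy j) (hy (S j)); intros; split; apply Rabs_le; lra. }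
  apply Rabs_le_between in h; lra.
Qed.

Lemma interp_dist (y z : nat -> R) (M : nat) (x e : R) : (0 < M)%nat -> 0 <= x <= 1 ->
  (forall j, Rabs (y j - z j) <= e) -> Rabs (interp y M x - interp z M x) <= e.
Proof.
  intros hM hx h.
  destruct (lap_exists M x hM hx) as [j [_ hj]].
  rewrite !(interp_lap _ M j x hj).
  assert (h0 := h j); assert (h1 := h (S j)); apply Rabs_le_between in h0, h1.
  apply Rabs_le; set (t := INR M * x - INR j).
  assert (0 <= t <= 1) by (unfold t; lra); nra.
Qed.

(** Each lap has slope at most [M]. If [M (v - u) >= 1], values in [[0,1]] suffice; otherwise [u]
    and [v] lie in the same lap or in adjacent ones, and the latter case is split at the common
    node. *)
Lemma interp_lipschitz_le (y : nat -> R) (M : nat) (u v : R) : (0 < M)%nat ->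
  0 <= u -> u <= v -> v <= 1 -> (forall j, 0 <= y j <= 1) ->
  Rabs (interp y M u - interp y M v) <= INR M * (v - u).
Proof.
  intros hM hu huv hv hy.
  destruct (lap_exists M u hM) as [i [_ hi]]; [lra|].
  destruct (lap_exists M v hM) as [j [_ hj]]; [lra|].
  assert (hM' := lt_INR _ _ hM); simpl in hM'.
  assert (huv' : INR M * u <= INR M * v) by nra.
  destruct (Rle_lt_dec 1 (INR M * (v - u))) as [h | h].
  { generalize (interp_bounds y M u hM ltac:(lra) hy)
      (interp_bounds y M v hM ltac:(lra) hy); intros.
    apply Rabs_le; lra. }
  generalize (hy i) (hy (S i)) (hy (S (S i))) (hy j) (hy (S j)); intros y0 y1 y2 y3 y4.
  destruct (Rle_lt_dec (INR M * v) (INR i + 1)) as [hvi | hvi].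
  - rewrite !(interp_lap y M i) by lra.
    apply Rabs_le; nra.
  - rewrite (interp_lap y M i u) by lra.
    rewrite (interp_lap y M (S i) v) by (rewrite S_INR; lra).
    rewrite S_INR.
    assert (e1 : 0 <= INR i + 1 - INR M * u) by lra.
    assert (e2 : 0 <= INR M * v - (INR i + 1)) by lra.
    apply Rabs_le; nra.
Qed.

Lemma interp_lipschitz (y : nat -> R) (M : nat) (u v : R) : (0 < M)%nat ->
  0 <= u <= 1 -> 0 <= v <= 1 -> (forall j, 0 <= y j <= 1) ->
  Rabs (interp y M u - interp y M v) <= INR M * Rabs (u - v).
Proof.
  intros hM hu hv hy; destruct (Rle_dec u v).
  - rewrite (Rabs_left1 (u - v)) by lra; rewrite Ropp_minus_distr.
    now apply interp_lipschitz_le.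
  - rewrite Rabs_minus_sym, (Rabs_pos_eq (u - v)) by lra.
    apply interp_lipschitz_le; auto; lra.
Qed.

Lemma affine_surj (c D t1 t2 z : R) : D <> 0 ->
  (c + D * t1 <= z <= c + D * t2 \/ c + D * t2 <= z <= c + D * t1) -> t1 <= t2 ->
  exists t, t1 <= t <= t2 /\ c + D * t = z.
Proof.
  intros hD hz ht; exists ((z - c) / D).
  assert (e : D * ((z - c) / D) = z - c) by (field; exact hD).
  split; [|lra].
  set (t := (z - c) / D) in *.
  destruct (Rtotal_order D 0) as [h | [h | h]]; [|lra|]; destruct hz; split; nra.
Qed.

(** * Zigzag perturbations *)

(** For [a >= 0] each node needs truncation on one side only. Beyond index [M] the clamp evaluates
    [f] at [1], so that all indices have a value. *)
Definition zig_node (f : J -> J) (a : R) (M j : nat) : R :=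
  let v := jval (f (clampJ (INR j / INR M))) in
  if Nat.even j then Rmin 1 (v + a) else Rmax 0 (v - a).

Definition zigzag (f : J -> J) (a : R) (M : nat) (x : J) : J :=
  clampJ (interp (zig_node f a M) M (jval x)).

Lemma zig_node_bounds (f : J -> J) (a : R) (M j : nat) :
  0 <= a -> 0 <= zig_node f a M j <= 1.
Proof.
  intros ha; unfold zig_node.
  generalize (jval_bounds (f (clampJ (INR j / INR M)))).
  set (v := jval _); intros hv.
  destruct (Nat.even j); unfold Rmin, Rmax; destruct Rle_dec; lra.
Qed.

Lemma zig_node_close (f : J -> J) (a : R) (M j : nat) : 0 <= a ->
  Rabs (zig_node f a M j - jval (f (clampJ (INR j / INR M)))) <= a.
Proof.
  intros ha; unfold zig_node.
  generalize (jval_bounds (f (clampJ (INR j / INR M)))).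
  set (v := jval _); intros hv; apply Rabs_le.
  destruct (Nat.even j); unfold Rmin, Rmax; destruct Rle_dec; lra.
Qed.

(** Both nodes are shifted in the same direction, as this depends on [j] alone, and truncation is
    1-Lipschitz. *)
Lemma zig_node_dist (f h : J -> J) (a b : R) (M j : nat) :
  Rabs (zig_node f a M j - zig_node h b M j) <= dsup f h + Rabs (a - b).
Proof.
  unfold zig_node.
  generalize (dsup_ge f h (clampJ (INR j / INR M))).
  set (v := jval (f _)); set (w := jval (h _)); set (d := dsup f h).
  destruct (Nat.even j); unfold Rmin, Rmax; repeat destruct Rle_dec;
    unfold Rabs; repeat destruct Rcase_abs; lra.
Qed.

Lemma zigzag_val (f : J -> J) (a : R) (M : nat) (x : J) : (0 < M)%nat -> 0 <= a ->
  jval (zigzag f a M x) = interp (zig_node f a M) M (jval x).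
Proof.
  intros hM ha; apply clampJ_val, interp_bounds; auto using jval_bounds.
  intros j; now apply zig_node_bounds.
Qed.

Lemma zigzag_cont (f : J -> J) (a : R) (M : nat) : (0 < M)%nat -> 0 <= a ->
  cont_map (zigzag f a M).
Proof.
  intros hM ha x e he.
  assert (hM' := lt_INR _ _ hM); simpl in hM'.
  exists (e / INR M); split; [now apply Rdiv_lt_0_compat|].
  intros y hy; rewrite !zigzag_val by assumption.
  apply Rle_lt_trans with (1 := interp_lipschitz _ M _ _ hM (jval_bounds y) (jval_bounds x)
    (fun j => zig_node_bounds f a M j ha)).
  apply (Rmult_lt_compat_l _ _ _ hM') in hy.
  now replace (INR M * (e / INR M)) with e in hy by (field; lra).
Qed.

(** For a fixed mesh this is joint continuity in the map and the amplitude, which will make the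
    approximation continuous in the parameter [k]. *)
Lemma zigzag_dist (f h : J -> J) (a b : R) (M : nat) : (0 < M)%nat -> 0 <= a -> 0 <= b ->
  dsup (zigzag f a M) (zigzag h b M) <= dsup f h + Rabs (a - b).
Proof.
  intros hM ha hb; apply dsup_le; intros x.
  rewrite !zigzag_val by assumption.
  apply interp_dist; auto using jval_bounds, zig_node_dist.
Qed.

Lemma zigzag_pl (f : J -> J) (a : R) (M : nat) : (0 < M)%nat -> 0 <= a ->
  piecewise_linear (zigzag f a M).
Proof.
  intros hM ha; assert (hM' := lt_INR _ _ hM); simpl in hM'.
  exists M, (fun i => INR i / INR M); split.
  - split; [simpl; field; lra | split; [field; lra|]].
    intros i _; rewrite S_INR; apply Rmult_lt_compat_r; [now apply Rinv_0_lt_compat | lra].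
  - intros i _; set (y := zig_node f a M).
    exists ((y (S i) - y i) * INR M), (y i - (y (S i) - y i) * INR i).
    intros x [h1 h2]; rewrite zigzag_val by assumption.
    rewrite S_INR in h2.
    apply (Rmult_le_compat_l (INR M)) in h1, h2; try lra.
    replace (INR M * (INR i / INR M)) with (INR i) in h1 by (field; lra).
    replace (INR M * ((INR i + 1) / INR M)) with (INR i + 1) in h2 by (field; lra).
    fold y; rewrite (interp_lap y M i) by lra; ring.
Qed.

(* The mesh [1/M] is fine both for the amplitude [a] and for the modulus of continuity of [f]. *)
Definition fine_mesh (f : J -> J) (a : R) (M : nat) : Prop :=
  (0 < M)%nat /\ 0 < a < 1 /\ 4 <= INR M * a /\
  forall x y : J, Rabs (jval x - jval y) <= / INR M ->
    Rabs (jval (f x) - jval (f y)) <= a / 10.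

(** * Zigzags over a fine mesh: closeness, steepness and covering *)

Section FineZigzag.

Variables (f : J -> J) (a : R) (M : nat).
Hypothesis fine : fine_mesh f a M.

Let g := zigzag f a M.
Let y := zig_node f a M.

Lemma fine_pos : (0 < M)%nat.
Proof. apply fine. Qed.

Lemma fine_INR : 0 < INR M.
Proof. apply (lt_INR 0), fine. Qed.

Lemma fine_amp : 0 < a < 1.
Proof. apply fine. Qed.

Lemma fine_osc (x : J) (j i : nat) : (j < M)%nat ->
  INR j <= INR M * jval x <= INR j + 1 -> (i = j \/ i = S j) ->
  Rabs (jval (f (clampJ (INR i / INR M))) - jval (f x)) <= a / 10.
Proof.
  intros hj hx hi; apply fine.
  assert (hM := fine_INR).
  assert (hi' : INR j <= INR i <= INR j + 1) by (destruct hi as [-> | ->]; rewrite ?S_INR; lra).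
  assert (hiM : INR i <= INR M).
  { apply le_INR; lia. }
  rewrite clampJ_val.
  2:{ split; [apply Rdiv_le_0_compat; [apply pos_INR | lra]|].
      apply Rle_div_l; lra. }
  replace (INR i / INR M - jval x) with ((INR i - INR M * jval x) * / INR M) by (field; lra).
  assert (h := Rinv_0_lt_compat _ hM).
  rewrite Rabs_mult, (Rabs_pos_eq (/ INR M)) by lra.
  assert (Rabs (INR i - INR M * jval x) <= 1) by (apply Rabs_le; lra).
  nra.
Qed.

Lemma fine_lap (x : J) (j : nat) : INR j <= INR M * jval x <= INR j + 1 ->
  jval (g x) = y j + (y (S j) - y j) * (INR M * jval x - INR j).
Proof.
  intros hx; unfold g; rewrite zigzag_val by (generalize fine_pos fine_amp; auto; lra).
  now apply interp_lap.
Qed.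

Lemma fine_node (j : nat) : (j <= M)%nat -> jval (g (clampJ (INR j / INR M))) = y j.
Proof.
  intros hj; assert (hM := fine_INR); apply le_INR in hj.
  assert (e : jval (clampJ (INR j / INR M)) = INR j / INR M).
  { apply clampJ_val; split; [apply Rdiv_le_0_compat; [apply pos_INR | lra]|].
    apply Rle_div_l; lra. }
  rewrite (fine_lap _ j); rewrite e;
    replace (INR M * (INR j / INR M)) with (INR j) by (field; lra); lra.
Qed.

(** A node moves by at most [a], and [f] varies by at most [a/10] between [x] and the ends of its
    lap; convexity gives [11a/10]. *)
Lemma fine_close : dsup f g <= 2 * a.
Proof.
  assert (ha := fine_amp); assert (hM := fine_pos).
  apply dsup_le; intros x; rewrite Rabs_minus_sym.
  destruct (lap_exists M (jval x) hM (jval_bounds x)) as [j [hjM hj]].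
  rewrite (fine_lap x j hj).
  assert (c0 := zig_node_close f a M j ltac:(lra)).
  assert (c1 := zig_node_close f a M (S j) ltac:(lra)).
  assert (o0 := fine_osc x j j hjM hj ltac:(auto)).
  assert (o1 := fine_osc x j (S j) hjM hj ltac:(auto)).
  fold (y j) in c0; fold (y (S j)) in c1.
  apply Rabs_le_between in c0, c1, o0, o1; apply Rabs_le.
  set (t := INR M * jval x - INR j).
  assert (0 <= t <= 1) by (unfold t; lra); nra.
Qed.

(* Over one lap the zigzag covers the [a/2]-neighbourhood of the image of [f]. *)
Lemma fine_node_range (x : J) (j : nat) : (j < M)%nat ->
  INR j <= INR M * jval x <= INR j + 1 ->
  let lo := if Nat.even j then y (S j) else y j in
  let hi := if Nat.even j then y j else y (S j) in
  lo <= Rmax 0 (jval (f x) - a / 2) /\ Rmin 1 (jval (f x) + a / 2) <= hi /\ lo + a <= hi.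
Proof.
  intros hjM hj; simpl.
  assert (ha := fine_amp).
  assert (o0 := fine_osc x j j hjM hj ltac:(auto)).
  assert (o1 := fine_osc x j (S j) hjM hj ltac:(auto)).
  (* Consecutive nodes have opposite parity: one is pushed up, the other down. *)
  unfold y, zig_node; rewrite Nat.even_succ, <- Nat.negb_even.
  generalize (jval_bounds (f (clampJ (INR j / INR M))))
    (jval_bounds (f (clampJ (INR (S j) / INR M)))) (jval_bounds (f x)).
  apply Rabs_le_between in o0, o1; revert o0 o1.
  set (v0 := jval (f (clampJ (INR j / INR M)))).
  set (v1 := jval (f (clampJ (INR (S j) / INR M)))).
  set (v := jval (f x)); intros.
  destruct (Nat.even j); cbn -[Rmin Rmax]; unfold Rmin, Rmax; repeat destruct Rle_dec; lra.
Qed.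

(** Even nodes are peaks and odd nodes valleys. As a lap has length [1/M] and [4 <= INR M * a],
    every slope is at least [4] in absolute value. *)
Lemma fine_node_gap (j : nat) : (j < M)%nat ->
  if Nat.even j then y (S j) + a <= y j else y j + a <= y (S j).
Proof.
  intros hj; assert (hM := fine_INR).
  assert (e : jval (clampJ (INR j / INR M)) = INR j / INR M).
  { apply lt_INR in hj.
    apply clampJ_val; split; [apply Rdiv_le_0_compat; [apply pos_INR | lra]|].
    apply Rle_div_l; lra. }
  destruct (fine_node_range (clampJ (INR j / INR M)) j hj) as [_ [_ h]].
  { rewrite e; replace (INR M * (INR j / INR M)) with (INR j) by (field; lra); lra. }
  destruct (Nat.even j); exact h.
Qed.

(** In the coordinate [t = M w - j] the lap is affine with nonzero slope, so a preimage solves a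
    linear equation. The two orders of the ends account for rising and falling laps. *)
Lemma fine_cover_segment (j : nat) (t1 t2 : R) (z : J) : (j < M)%nat ->
  0 <= t1 -> t1 <= t2 -> t2 <= 1 ->
  (y j + (y (S j) - y j) * t1 <= jval z <= y j + (y (S j) - y j) * t2 \/
   y j + (y (S j) - y j) * t2 <= jval z <= y j + (y (S j) - y j) * t1) ->
  exists w : J, t1 <= INR M * jval w - INR j <= t2 /\ g w = z.
Proof.
  intros hj h1 h12 h2 hz; assert (hM := fine_INR).
  assert (hgap := fine_node_gap j hj); assert (ha := fine_amp).
  destruct (affine_surj (y j) (y (S j) - y j) t1 t2 (jval z)) as [t [ht e]]; auto.
  { destruct (Nat.even j); lra. }
  assert (hj' : INR j + 1 <= INR M) by (rewrite <- S_INR; apply le_INR; lia).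
  assert (hw : jval (clampJ ((INR j + t) / INR M)) = (INR j + t) / INR M).
  { generalize (pos_INR j); intros; apply clampJ_val; split.
    - apply Rdiv_le_0_compat; lra.
    - apply Rle_div_l; lra. }
  assert (e' : INR M * ((INR j + t) / INR M) = INR j + t) by (field; lra).
  exists (clampJ ((INR j + t) / INR M)); split.
  - rewrite hw, e'; lra.
  - apply jval_inj; rewrite (fine_lap _ j); rewrite hw, e'; [|lra].
    rewrite <- e; ring.
Qed.

(** Since [z] lies in [[0,1]], the truncated ends in [fine_node_range] lose nothing. *)
Lemma fine_cover_near (x z : J) (j : nat) : (j < M)%nat ->
  INR j <= INR M * jval x <= INR j + 1 -> Rabs (jval z - jval (f x)) <= a / 2 ->
  exists w : J, INR j <= INR M * jval w <= INR j + 1 /\ g w = z.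
Proof.
  intros hj hx hz.
  destruct (fine_cover_segment j 0 1 z hj) as [w [hw e]]; try lra.
  - destruct (fine_node_range x j hj hx) as [h1 [h2 _]].
    assert (hzb := jval_bounds z); apply Rabs_le_between in hz.
    revert h1 h2; unfold Rmax, Rmin; repeat destruct Rle_dec; destruct (Nat.even j); lra.
  - exists w; split; [lra | exact e].
Qed.

(** * Expansion of intervals and transitivity of the zigzag *)

Definition covers (U : J -> Prop) (n : nat) (u v : R) : Prop :=
  forall z : J, u <= jval z <= v -> exists x, U x /\ Nat.iter n g x = z.

(** Inside one lap the image of [[u,v]] is the segment between the images [A] and [B] of its ends,
    stretched by a slope of at least [4]; the parity of [j] decides which end is lower. *)
Lemma covers_expand_lap (U : J -> Prop) (n j : nat) (u v : R) : (j < M)%nat ->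
  INR j <= INR M * u -> u < v -> INR M * v <= INR j + 1 -> covers U n u v ->
  exists u' v', 0 <= u' /\ v' <= 1 /\ 4 * (v - u) <= v' - u' /\ covers U (S n) u' v'.
Proof.
  intros hj hu huv hv hc; assert (hM := fine_INR).
  assert (hgap := fine_node_gap j hj).
  assert (ha := fine_amp); assert (hMa := proj1 (proj2 (proj2 fine))).
  set (t1 := INR M * u - INR j); set (t2 := INR M * v - INR j).
  set (A := y j + (y (S j) - y j) * t1); set (B := y j + (y (S j) - y j) * t2).
  assert (hb0 : 0 <= y j <= 1) by (apply zig_node_bounds; lra).
  assert (hb1 : 0 <= y (S j) <= 1) by (apply zig_node_bounds; lra).
  assert (ht : 0 <= t1 /\ t1 <= t2 /\ t2 <= 1) by (unfold t1, t2; repeat split; nra).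
  assert (hA : 0 <= A <= 1) by (unfold A; nra).
  assert (hB : 0 <= B <= 1) by (unfold B; nra).
  assert (hcov : forall z : J, (A <= jval z <= B \/ B <= jval z <= A) ->
    exists x, U x /\ Nat.iter (S n) g x = z).
  { intros z hz.
    destruct (fine_cover_segment j t1 t2 z hj) as [w [hw e]]; try tauto.
    destruct (hc w) as [x [hx e']].
    { unfold t1, t2 in hw; split; apply Rmult_le_reg_l with (INR M); lra. }
    exists x; split; [exact hx|]; simpl; now rewrite e'. }
  assert (hlen : t2 - t1 = INR M * (v - u)) by (unfold t1, t2; ring).
  assert (hlen' : 4 * (v - u) <= a * (t2 - t1)) by (rewrite hlen; nra).
  destruct (Nat.even j).
  - exists B, A; repeat split; try tauto.
    + unfold A, B; nra.
    + intros z hz; apply hcov; now right.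
  - exists A, B; repeat split; try tauto.
    + unfold A, B; nra.
    + intros z hz; apply hcov; now left.
Qed.

Definition covers_lap (U : J -> Prop) : Prop :=
  exists n j, (j < M)%nat /\ covers U n (INR j / INR M) ((INR j + 1) / INR M).

Lemma covers_sub (U : J -> Prop) (n : nat) (u v u' v' : R) :
  u <= u' -> v' <= v -> covers U n u v -> covers U n u' v'.
Proof. intros hu hv hc z hz; apply hc; lra. Qed.

(** An interval that contains no full lap meets at most one node [b] in its interior. The longer of
    the two pieces has at least half the length and is stretched by [4], hence the factor [2]. *)
Lemma covers_expand (U : J -> Prop) (n : nat) (u v : R) :
  0 <= u -> u < v -> v <= 1 -> covers U n u v -> covers_lap U \/
  exists u' v', 0 <= u' /\ v' <= 1 /\ 2 * (v - u) <= v' - u' /\ covers U (S n) u' v'.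
Proof.
  intros hu huv hv hc; assert (hM := fine_INR).
  destruct (floor_nat (INR M * u)) as [h1 h2]; [nra|].
  set (j := Z.to_nat _) in *.
  assert (hj : (j < M)%nat) by (apply INR_lt; nra).
  destruct (Rle_lt_dec (INR M * v) (INR j + 1)) as [h | h].
  { right; destruct (covers_expand_lap U n j u v) as [u' [v' h']]; auto.
    exists u', v'; repeat split; try tauto; lra. }
  assert (hj1 : (S j < M)%nat) by (apply INR_lt; rewrite S_INR; nra).
  set (b := (INR j + 1) / INR M).
  assert (eb : INR M * b = INR j + 1) by (unfold b; field; lra).
  assert (hub : u < b) by (apply Rmult_lt_reg_l with (INR M); lra).
  assert (hbv : b < v) by (apply Rmult_lt_reg_l with (INR M); lra).
  destruct (Rle_lt_dec (INR j + 2) (INR M * v)) as [h' | h'].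
  - left; exists n, (S j); split; [exact hj1|].
    apply covers_sub with (3 := hc); rewrite S_INR.
    + fold b; lra.
    + apply Rle_div_l; lra.
  - right; destruct (Rle_lt_dec (v - u) (2 * (b - u))) as [hh | hh].
    + destruct (covers_expand_lap U n j u b) as [u' [v' hx]]; auto; try lra.
      { apply covers_sub with (3 := hc); lra. }
      exists u', v'; repeat split; try tauto; lra.
    + destruct (covers_expand_lap U n (S j) b v) as [u' [v' hx]]; auto;
        try (rewrite S_INR; lra).
      { apply covers_sub with (3 := hc); lra. }
      exists u', v'; repeat split; try tauto; lra.
Qed.

(** Starting from a small interval inside [U], the covered length doubles at each step until a lap
    is covered; it cannot double forever inside [[0,1]]. *)
Lemma open_covers_lap (U : J -> Prop) : openI U -> (exists x, U x) -> covers_lap U.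
Proof.
  intros hU [x hx]; destruct (hU x hx) as [r [hr h]].
  assert (hxb := jval_bounds x).
  assert (h0 : exists u v, 0 <= u /\ u < v /\ v <= 1 /\ covers U 0 u v).
  { exists (Rmax 0 (jval x - r / 2)), (Rmin 1 (jval x + r / 2)).
    repeat split; try (unfold Rmax, Rmin; repeat destruct Rle_dec; lra).
    intros z hz; exists z; split; [|reflexivity]; apply h, Rabs_def1;
      revert hz; unfold Rmax, Rmin; repeat destruct Rle_dec; lra. }
  destruct h0 as [u [v [hu [huv [hv hc]]]]].
  assert (grow : forall m, covers_lap U \/ exists n u' v',
    0 <= u' /\ v' <= 1 /\ 2 ^ m * (v - u) <= v' - u' /\ covers U n u' v').
  { induction m as [|m [IH | [n [u' [v' [h1 [h2 [h3 h4]]]]]]]].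
    - right; exists 0%nat, u, v; repeat split; auto; simpl; lra.
    - now left.
    - assert (0 < 2 ^ m) by (apply pow_lt; lra).
      destruct (covers_expand U n u' v') as [hl | [u'' [v'' hh]]]; auto; [nra|].
      right; exists (S n), u'', v''; repeat split; try tauto; simpl; nra. }
  destruct (Pow_x_infinity 2 ltac:(rewrite Rabs_pos_eq; lra) (2 / (v - u))) as [m hm].
  specialize (hm m (le_n _)); rewrite Rabs_pos_eq in hm by (apply pow_le; lra).
  destruct (grow m) as [hl | [n [u' [v' [h1 [h2 [h3 h4]]]]]]]; [exact hl|].
  exfalso; apply Rge_le, Rle_div_l in hm; lra.
Qed.

(* An orbit of a transitive map near [f] is a pseudo-orbit of [f], and every lap met by it is
   covered by an iterate of the lap where it starts. *)
Lemma lap_covers_point (j : nat) (q : J) : TI_closure f -> (j < M)%nat ->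
  exists n w, (1 <= n)%nat /\ INR j <= INR M * jval w <= INR j + 1 /\ Nat.iter n g w = q.
Proof.
  intros [_ hcl] hj; assert (ha := fine_amp); assert (hM := fine_INR).
  destruct (hcl (a / 16)) as [h [[hc ht] hd]]; [lra|].
  assert (hj' : INR j + 1 <= INR M) by (rewrite <- S_INR; apply le_INR; lia).
  destruct (ht (fun x => INR j < INR M * jval x < INR j + 1)
    (fun x => Rabs (jval x - jval q) < a / 16)) as [n [hn [x [hx hq]]]].
  - intros x hx.
    exists (Rmin ((INR M * jval x - INR j) / INR M) ((INR j + 1 - INR M * jval x) / INR M)).
    split.
    + apply Rmin_glb_lt; apply Rdiv_lt_0_compat; lra.
    + intros z hz.
      assert (z1 := Rlt_le_trans _ _ _ hz (Rmin_l _ _)).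
      assert (z2 := Rlt_le_trans _ _ _ hz (Rmin_r _ _)).
      apply Rabs_def2 in z1, z2.
      destruct z1 as [_ z1], z2 as [z2 _].
      apply (Rmult_lt_compat_l (INR M)) in z1, z2; auto.
      replace (INR M * - ((INR M * jval x - INR j) / INR M))
        with (- (INR M * jval x - INR j)) in z1 by (field; lra).
      replace (INR M * ((INR j + 1 - INR M * jval x) / INR M))
        with (INR j + 1 - INR M * jval x) in z2 by (field; lra).
      lra.
  - intros x hx; exists (a / 16 - Rabs (jval x - jval q)); split; [lra|].
    intros z hz.
    replace (jval z - jval q) with ((jval z - jval x) + (jval x - jval q)) by ring.
    apply Rle_lt_trans with (1 := Rabs_triang _ _); lra.
  - exists (clampJ ((INR j + / 2) / INR M)); generalize (pos_INR j); intros.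
    rewrite clampJ_val.
    + replace (INR M * ((INR j + / 2) / INR M)) with (INR j + / 2) by (field; lra); lra.
    + split; [apply Rdiv_le_0_compat; lra | apply Rle_div_l; lra].
  - exists q; rewrite Rminus_diag, Rabs_R0; lra.
  - assert (hmesh : 4 <= INR M * a) by apply fine.
    (* The transitive [h] is [a/16]-close to [f], and [a/4 + a/16 < a/2]. *)
    assert (near : forall (s z : J), Rabs (jval z - jval (h s)) <= a / 4 ->
      Rabs (jval z - jval (f s)) <= a / 2).
    { intros s z hz; assert (hs := dsup_ge f h s).
      apply Rabs_le_between in hz, hs; apply Rabs_le; lra. }
    (* The claim is made for every target [z] near the orbit point: a preimage of [z] in the lap of
       the previous orbit point becomes the target one step earlier. *)
    assert (inv : forall i (z : J), Rabs (jval z - jval (Nat.iter (S i) h x)) <= a / 4 ->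
      exists w, INR j <= INR M * jval w <= INR j + 1 /\ Nat.iter (S i) g w = z).
    { induction i as [|i IH]; intros z hz.
      - apply (fine_cover_near x); [exact hj | lra | now apply near].
      - simpl in hz; apply near in hz.
        set (s := h (Nat.iter i h x)) in *.
        destruct (lap_exists M (jval s) fine_pos (jval_bounds s)) as [l [hl hs]].
        destruct (fine_cover_near s z l hl hs hz) as [w [hw e]].
        destruct (IH w) as [w' [hw' e']].
        (* [w] and [s] share a lap, whose length [1/M] is at most [a/4]. *)
        { simpl; fold s; apply Rabs_le; split; apply Rmult_le_reg_l with (INR M); lra. }
        exists w'; split; [exact hw'|].
        change (g (Nat.iter (S i) g w') = z); now rewrite e'. }
    destruct n as [|i]; [lia|].
    destruct (inv i q) as [w [hw e]].
    { rewrite Rabs_minus_sym; lra. }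
    exists (S i), w; repeat split; auto; lra.
Qed.

(** [n] steps spread [U] over a lap, and [m] further steps carry some point of that lap exactly to
    [q]. *)
Lemma fine_transitive : TI_closure f -> transitive g.
Proof.
  intros hf U V hU hV hxU [q hq].
  destruct (open_covers_lap U hU hxU) as [n [j [hj hc]]].
  destruct (lap_covers_point j q hf hj) as [m [w [hm [hw e]]]].
  assert (hM := fine_INR).
  destruct (hc w) as [x [hx e']].
  { split; [apply Rle_div_l | apply Rle_div_r]; lra. }
  exists (m + n)%nat; split; [lia|]; exists x; split; [exact hx|].
  rewrite Nat.iter_add, e', e; exact hq.
Qed.

Lemma fine_TPL : TI_closure f -> TPL g.
Proof.
  assert (ha := fine_amp); assert (hM := fine_pos).
  intros hf; split; [split|].
  - apply zigzag_cont; auto; lra.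
  - now apply fine_transitive.
  - apply zigzag_pl; auto; lra.
Qed.

End FineZigzag.

(** * Meshes uniform over the parameter space, and separation of different meshes *)

Lemma fine_mesh_exists {K : Type} (dK : K -> K -> R) (f : K -> J -> J) (a : K -> R) :
  is_metric dK -> compact_metric dK -> (forall k, cont_map (f k)) -> cont_into dK f ->
  (forall k, 0 < a k < 1) ->
  (forall k e, 0 < e -> exists delta, 0 < delta /\
    forall k', dK k k' < delta -> Rabs (a k' - a k) < e) ->
  exists m, forall N, (m <= N)%nat -> forall k, fine_mesh (f k) (a k) N.
Proof.
  intros hd hK hf hcont ha hacont.
  (* A single [t] bounds all amplitudes from below and serves as a modulus for all [f k] at once. *)
  destruct (compact_uniform dK (fun t k => t <= a k /\ forall x y : J,
    Rabs (jval x - jval y) <= t -> Rabs (jval (f k x) - jval (f k y)) <= a k / 10))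
    as [t [ht h]]; auto.
  - intros s t k hs hst [h1 h2]; split; [lra|]; intros x y hxy; apply h2; lra.
  - intros k0; assert (ha0 := ha k0).
    (* Near [k0] the amplitude exceeds [a k0 / 2], and three errors of [a k0 / 100] stay below a
       tenth of that. *)
    destruct (cont_map_unif _ (hf k0) (a k0 / 100)) as [d [hd0 hunif]]; [lra|].
    destruct (hcont k0 (a k0 / 100)) as [r1 [hr1 h1]]; [lra|].
    destruct (hacont k0 (a k0 / 2)) as [r2 [hr2 h2]]; [lra|].
    exists (Rmin r1 r2), (Rmin (a k0 / 2) (d / 2)).
    split; [now apply Rmin_glb_lt|]; split; [apply Rmin_glb_lt; lra|].
    intros k hk.
    specialize (h1 k (Rlt_le_trans _ _ _ hk (Rmin_l _ _))).
    specialize (h2 k (Rlt_le_trans _ _ _ hk (Rmin_r _ _))).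
    apply Rabs_def2 in h2.
    split; [apply Rle_trans with (1 := Rmin_l _ _); lra|].
    intros x y hxy.
    assert (hxy' := Rle_trans _ _ _ hxy (Rmin_r _ _)).
    assert (u := hunif x y ltac:(lra)).
    assert (e1 := dsup_ge (f k0) (f k) x); assert (e2 := dsup_ge (f k0) (f k) y).
    apply Rabs_def2 in u; apply Rabs_le_between in e1, e2.
    apply Rabs_le; lra.
  - destruct (INR_unbounded (4 / t)) as [m hm].
    exists m; intros N hN k; destruct (h k) as [h1 h2].
    apply le_INR in hN.
    assert (ht4 : 0 < 4 / t) by (apply Rdiv_lt_0_compat; lra).
    assert (hN4 : 4 <= INR N * t).
    { apply Rle_div_l; lra. }
    assert (hN0 : 0 < INR N) by lra.
    split; [now apply INR_lt|]; split; [apply ha|]; split; [nra|].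
    intros x y hxy; apply h2; apply Rle_trans with (1 := hxy).
    apply Rmult_le_reg_l with (INR N); auto; rewrite Rinv_r; lra.
Qed.

(* On the first lap of the coarser zigzag, which is decreasing, the finer one climbs by [a]. *)
Lemma zigzag_separated (f f' : J -> J) (a a' : R) (M M' : nat) :
  fine_mesh f a M -> fine_mesh f' a' M' -> (2 * M' <= M)%nat ->
  a <= 2 * dsup (zigzag f a M) (zigzag f' a' M').
Proof.
  intros hf hf' hMM.
  assert (hM := fine_INR _ _ _ hf); assert (hM' := fine_INR _ _ _ hf').
  assert (hM'0 := fine_pos _ _ _ hf').
  assert (ha' := fine_amp _ _ _ hf').
  (* The finer zigzag rises from its valley at [1/M] to its peak at [2/M], and [2 * M' <= M] places
     both inside the first lap [[0, 1/M']] of the coarser one. The distance is paid at both ends,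
     hence the factor [2]. *)
  set (u := clampJ (INR 1 / INR M)); set (v := clampJ (INR 2 / INR M)).
  assert (hMM' := le_INR _ _ hMM); rewrite mult_INR in hMM'; simpl in hMM'.
  assert (hM'1 : 1 <= INR M') by (apply (le_INR 1); lia).
  assert (hu : INR M * jval u = 1).
  { unfold u; rewrite clampJ_val; [simpl; field; lra|].
    simpl; split; [apply Rdiv_le_0_compat | apply Rle_div_l]; lra. }
  assert (hv : INR M * jval v = 2).
  { unfold v; rewrite clampJ_val; [simpl; field; lra|].
    simpl; split; [apply Rdiv_le_0_compat | apply Rle_div_l]; lra. }
  assert (gu := fine_node _ _ _ hf 1 ltac:(lia)); fold u in gu.
  assert (gv := fine_node _ _ _ hf 2 ltac:(lia)); fold v in gv.
  assert (gap := fine_node_gap _ _ _ hf 1 ltac:(lia)); cbn [Nat.even] in gap.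
  assert (gap' := fine_node_gap _ _ _ hf' 0 ltac:(lia)); cbn [Nat.even] in gap'.
  assert (hub := jval_bounds u); assert (hvb := jval_bounds v).
  assert (huv : jval u <= jval v) by (apply Rmult_le_reg_l with (INR M); lra).
  assert (hv1 : INR M' * jval v <= 1) by nra.
  assert (gu' := fine_lap _ _ _ hf' u 0); assert (gv' := fine_lap _ _ _ hf' v 0).
  simpl INR in gu', gv'; specialize (gu' ltac:(nra)); specialize (gv' ltac:(nra)).
  assert (du := dsup_ge (zigzag f a M) (zigzag f' a' M') u).
  assert (dv := dsup_ge (zigzag f a M) (zigzag f' a' M') v).
  apply Rabs_le_between in du, dv.
  assert (huv' : INR M' * jval u <= INR M' * jval v) by nra.
  assert (jval (zigzag f' a' M' v) <= jval (zigzag f' a' M' u)).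
  { rewrite gu', gv'; apply Rplus_le_compat_l, Rmult_le_compat_neg_l; lra. }
  lra.
Qed.

(** * Assembling the discrete approximation *)

Lemma TI_TI_closure (f : J -> J) : TI f -> TI_closure f.
Proof.
  intros hf; split; [apply hf|]; intros e he; exists f; split; [exact hf|].
  generalize (dsup_refl f); lra.
Qed.

Lemma pl_pm (f : J -> J) : piecewise_linear f -> piecewise_monotone f.
Proof.
  intros [m [a [ha h]]]; exists m, a; split; [exact ha|].
  intros i hi; destruct (h i hi) as [s [c hs]].
  destruct (Rle_lt_dec 0 s) as [h0 | h0]; [left | right];
    intros x y h1 h2 h3; rewrite !hs by lra; nra.
Qed.

(** The successor at [0] keeps all terms positive, so that doubling makes them grow strictly and the
    meshes shrink to [0]. *)
Fixpoint doubling (mu : nat -> nat) (n : nat) : nat :=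
  match n with
  | O => S (mu O)
  | S n => (mu (S n) + 2 * doubling mu n)%nat
  end.

Lemma doubling_ge (mu : nat -> nat) (n : nat) : (mu n <= doubling mu n)%nat.
Proof. destruct n; simpl; lia. Qed.

Lemma doubling_gt (mu : nat -> nat) (n : nat) : (n < doubling mu n)%nat.
Proof. induction n; simpl; lia. Qed.

Lemma doubling_lt (mu : nat -> nat) (n m : nat) :
  (m < n)%nat -> (2 * doubling mu m <= doubling mu n)%nat.
Proof.
  induction 1; simpl in *; [lia|].
  generalize (doubling_gt mu m0); lia.
Qed.

Lemma doubling_mono (mu : nat -> nat) (n m : nat) :
  (m <= n)%nat -> (doubling mu m <= doubling mu n)%nat.
Proof. induction 1; simpl; lia. Qed.

(** One statement serves the four spaces: the zigzags land in the smallest of them, while the given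
    maps and the limit point [p] are only known to lie in the largest. *)
Theorem SDAP_between (X : (J -> J) -> Prop) :
  (forall f, TPL f -> X f) -> (forall f, X f -> TI_closure f) -> SDAP X.
Proof.
  intros hlow hup eps heps hceps K dK hd hK f hX hcf.
  (* By [fine_close] the zigzag moves the map by at most [2 a = eps / 2]. *)
  set (a := fun k n => eps (f k n) / 4).
  assert (ha : forall k n, 0 < a k n < 1).
  { intros k n; generalize (heps _ (hX k n)); unfold a; lra. }
  assert (hac : forall n k e, 0 < e -> exists delta, 0 < delta /\
    forall k', dK k k' < delta -> Rabs (a k' n - a k n) < e).
  { intros n k e he.
    destruct (hceps _ (hX k n) e he) as [d [hd0 h]].
    destruct (hcf n k d hd0) as [d' [hd' h']].
    exists d'; split; [exact hd'|]; intros k' hk'.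
    specialize (h _ (hX k' n) (h' k' hk')).
    apply Rabs_def2 in h; apply Rabs_def1; unfold a; lra. }
  (* The threshold depends on [n] alone, so the mesh is constant over [K] and continuity in [k]
     follows from [zigzag_dist]. *)
  destruct (functional_choice (fun n m => forall N, (m <= N)%nat -> forall k,
    fine_mesh (f k n) (a k n) N)) as [mu hmu].
  { intros n.
    apply (fine_mesh_exists dK (fun k => f k n) (fun k => a k n)); auto.
    intros k; apply (hup _ (hX k n)). }
  set (M := doubling mu).
  assert (hfine : forall k n, fine_mesh (f k n) (a k n) (M n)).
  { intros k n; apply hmu, doubling_ge. }
  exists (fun k n => zigzag (f k n) (a k n) (M n)); repeat split.
  - intros k n; apply hlow, fine_TPL; auto.
  - intros n k e he.
    destruct (hcf n k (e / 2)) as [d1 [hd1 h1]]; [lra|].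
    destruct (hac n k (e / 2)) as [d2 [hd2 h2]]; [lra|].
    exists (Rmin d1 d2); split; [now apply Rmin_glb_lt|]; intros k' hk'.
    specialize (h1 k' (Rlt_le_trans _ _ _ hk' (Rmin_l _ _))).
    specialize (h2 k' (Rlt_le_trans _ _ _ hk' (Rmin_r _ _))).
    rewrite Rabs_minus_sym in h2.
    apply Rle_lt_trans with (dsup (f k n) (f k' n) + Rabs (a k n - a k' n)); [|lra].
    generalize (ha k n) (ha k' n); intros.
    apply zigzag_dist; [apply (hfine k n) | lra | lra].
  - intros p hp.
    assert (hep := heps p hp).
    destruct (hceps p hp (eps p / 2)) as [d [hd0 hde]]; [lra|].
    (* An amplitude below [d/4] would put [f k n] within [d/2 + 2 (d/4) = d] of [p]; there [eps]
       exceeds [eps p / 2], so the amplitude exceeds [eps p / 8]. *)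
    set (a0 := Rmin (d / 4) (eps p / 8)).
    assert (ha0 : 0 < a0) by (apply Rmin_glb_lt; lra).
    (* A zigzag near [p] has amplitude at least [a0]: otherwise [f k n] is near [p] as well,
       and [eps] is bounded below near [p]. *)
    assert (amp : forall k n, dsup p (zigzag (f k n) (a k n) (M n)) < d / 2 -> a0 <= a k n).
    { intros k n hpg; apply Rnot_lt_le; intros hlt.
      assert (l1 := Rlt_le_trans _ _ _ hlt (Rmin_l _ _)).
      assert (l2 := Rlt_le_trans _ _ _ hlt (Rmin_r _ _)).
      assert (c := fine_close _ _ _ (hfine k n)).
      assert (s := dsup_sym (zigzag (f k n) (a k n) (M n)) (f k n)).
      assert (t := dsup_triangle p (zigzag (f k n) (a k n) (M n)) (f k n)).
      specialize (hde _ (hX k n) ltac:(lra)).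
      apply Rabs_def2 in hde; unfold a in l2; lra. }
    destruct (proj1 (hup p hp) (clampJ 0) (a0 / 2)) as [d' [hd' hpc]]; [lra|].
    destruct (INR_unbounded (/ d')) as [N hN].
    assert (hMN : 0 < INR (M N)) by (apply (lt_INR 0), Nat.le_lt_trans with N;
      [lia | apply doubling_gt]).
    assert (hMNi := Rinv_0_lt_compat _ hMN).
    (* The three bounds serve [amp], [small] and [sep] respectively. *)
    set (r := Rmin (Rmin (d / 2) (a0 / 4)) (/ INR (M N))).
    assert (hr1 : r <= d / 2) by (unfold r; eauto using Rmin_l, Rle_trans).
    assert (hr2 : r <= a0 / 4).
    { unfold r; apply Rle_trans with (1 := Rmin_l _ _), Rmin_r. }
    assert (hr3 : r <= / INR (M N)) by apply Rmin_r.
    (* For [n >= N] the first lap is shorter than [d'], so [p] varies there by less than [a0/2];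
       with two errors below [a0/4] the zigzag could not fall by [a0]. *)
    assert (small : forall k n, dsup p (zigzag (f k n) (a k n) (M n)) < r -> (n < N)%nat).
    { intros k n hpg; apply Nat.nle_gt; intros hn.
      assert (hk := amp k n ltac:(lra)); assert (hf := hfine k n).
      assert (hM := fine_INR _ _ _ hf); assert (hM0 := fine_pos _ _ _ hf).
      assert (gap := fine_node_gap _ _ _ hf 0 hM0); cbn [Nat.even] in gap.
      assert (g0 := fine_node _ _ _ hf 0 ltac:(lia)).
      assert (g1 := fine_node _ _ _ hf 1 hM0).
      simpl INR in g0, g1; replace (0 / INR (M n)) with 0 in g0 by (field; lra).
      set (w := clampJ (1 / INR (M n))) in *.
      assert (hM1 : 1 <= INR (M n)) by (apply (le_INR 1); lia).
      assert (hw : jval w = / INR (M n)).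
      { unfold w; rewrite clampJ_val; [field; lra|].
        split; [apply Rdiv_le_0_compat | apply Rle_div_l]; lra. }
      assert (hwd : / INR (M n) < d').
      { rewrite <- (Rinv_inv d').
        assert (0 < / d') by now apply Rinv_0_lt_compat.
        apply Rinv_0_lt_contravar; [assumption|].
        assert (INR N <= INR (M n)); [|lra].
        apply le_INR; generalize (doubling_gt mu n); fold M; lia. }
      specialize (hpc w).
      rewrite hw, (clampJ_val 0), Rminus_0_r in hpc by lra.
      rewrite (Rabs_pos_eq (/ INR (M n))) in hpc
        by (apply Rlt_le, Rinv_0_lt_compat; lra).
      specialize (hpc hwd).
      assert (e0 := dsup_ge p (zigzag (f k n) (a k n) (M n)) (clampJ 0)).
      assert (e1 := dsup_ge p (zigzag (f k n) (a k n) (M n)) w).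
      rewrite g0 in e0; rewrite g1 in e1.
      apply Rabs_le_between in e0, e1; apply Rabs_def2 in hpc; lra. }
    (* Separation gives [a k n < 4 r <= 4 / M N], whereas [n < N] and the fine mesh give
       [a k n >= 4 / M n >= 4 / M N]. *)
    assert (sep : forall n m k k', (m < n)%nat ->
      dsup p (zigzag (f k n) (a k n) (M n)) < r ->
      dsup p (zigzag (f k' m) (a k' m) (M m)) < r -> False).
    { intros n m k k' hmn h1 h2.
      assert (hn := small k n h1).
      assert (s := zigzag_separated _ _ _ _ _ _ (hfine k n) (hfine k' m)
        (doubling_lt mu n m hmn)).
      assert (t := dsup_triangle (zigzag (f k n) (a k n) (M n)) p
        (zigzag (f k' m) (a k' m) (M m))).
      assert (t' := dsup_sym (zigzag (f k n) (a k n) (M n)) p).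
      destruct (hfine k n) as [_ [_ [h4 _]]].
      assert (hMn : INR (M n) <= INR (M N)) by (apply le_INR, doubling_mono; lia).
      assert (a k n < 4 * / INR (M N)) by lra.
      assert (INR (M N) * a k n < 4).
      { replace 4 with (INR (M N) * (4 * / INR (M N))) by (field; lra).
        now apply Rmult_lt_compat_l. }
      generalize (ha k n); nra. }
    exists r; split.
    + unfold r; repeat apply Rmin_glb_lt; lra.
    + intros n m [k h1] [k' h2].
      destruct (Nat.lt_trichotomy n m) as [h | [h | h]]; [exfalso | exact h | exfalso]; eauto.
  - intros k n; generalize (fine_close _ _ _ (hfine k n)) (heps _ (hX k n)).
    unfold a; lra.
Qed.

Theorem theorem3 : SDAP TI_closure /\ SDAP TI /\ SDAP TPL /\ SDAP TPM.
Proof.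
  repeat split; apply SDAP_between; unfold TPL, TPM;
    intuition auto using TI_TI_closure, pl_pm.
Qed.
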